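(* If $\mathcal{T}$ is a regular effective topology on $\mathcal{N}$, then $\mathcal{T}\subseteq\mathcal{S}$.
   Context: $\mathcal{N}=\omega^\omega$ is the Baire space. $\Sigma^1_1$ and $\Delta^1_1$ denote the lightface (effective, parameter-free) classes of subsets of $\mathcal{N}$. A topology on $\mathcal{N}$ is called an effective topology if it has a basis included in $\Sigma^1_1$ (i.e. a basis all of whose members are $\Sigma^1_1$ sets). The $\Delta$-topology $\mathcal{S}_\Delta$ is the topology on $\mathcal{N}$ with basis the $\Delta^1_1$ subsets of $\mathcal{N}$. The $\Sigma\Delta$-topology, denoted $\mathcal{S}$, is the topology on $\mathcal{N}$ with basis the $\Sigma^1_1$ subsets of $\mathcal{N}$ that are $\mathcal{S}_\Delta$-closed (a set $A\subseteq\mathcal{N}$ is $\mathcal{S}_\Delta$-closed iff $A=\bigcap\{D\in\Delta^1_1 : D\supseteq A\}$). *)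

(* Defs.v *)
From HB Require Import structures.
From mathcomp Require Import all_boot all_order all_classical.
From mathcomp Require Import topology.

Set Implicit Arguments.
Unset Strict Implicit.
Unset Printing Implicit Defensive.

Local Open Scope classical_set_scope.

Definition baire := nat -> nat.

(* Arithmetical formulas of second-order arithmetic with function variables.
   Number variables are de Bruijn indices, bound by [Ex]; function variables
   are free and named by natural numbers ([App i t] is the value of the i-th
   function variable at [t]). There are no function constants, so formulas
   are parameter-free. *)
Inductive term :=
  | Var of nat
  | Zero
  | Succ of term
  | Add of term & term
  | Mul of term & term
  | App of nat & term.

Inductive formula :=
  | Eq of term & term
  | Neg of formula
  | And of formula & formula
  | Ex of formula.

Fixpoint eval (F : nat -> baire) (v : nat -> nat) (t : term) : nat :=
  match t with
  | Var i => v i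
  | Zero => 0
  | Succ t => (eval F v t).+1
  | Add t u => eval F v t + eval F v u
  | Mul t u => eval F v t * eval F v u
  | App i t => F i (eval F v t)
  end.

Definition scons (n : nat) (v : nat -> nat) (i : nat) : nat :=
  if i is j.+1 then v j else n.

Fixpoint sat (F : nat -> baire) (v : nat -> nat) (p : formula) : Prop :=
  match p with
  | Eq t u => eval F v t = eval F v u
  | Neg p => ~ sat F v p
  | And p q => sat F v p /\ sat F v q
  | Ex p => exists n, sat F (scons n v) p
  end.

(* Lightface Sigma^1_1: definable by a block of existential function
   quantifiers in front of an arithmetical matrix [p]. Function variable 0 is
   the argument; all others are quantified, but only the finitely many that
   occur in [p] matter. Unbound number variables, if any, denote 0. *)
Definition Sigma11 (A : set baire) : Prop :=
  exists p : formula,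
    A = [set x | exists2 F : nat -> baire, F 0 = x & sat F (fun=> 0) p].

Definition Delta11 (A : set baire) : Prop := Sigma11 A /\ Sigma11 (~` A).

Fixpoint tren (r : nat -> nat) (t : term) : term :=
  match t with
  | Var i => Var i
  | Zero => Zero
  | Succ t => Succ (tren r t)
  | Add t u => Add (tren r t) (tren r u)
  | Mul t u => Mul (tren r t) (tren r u)
  | App i t => App (r i) (tren r t)
  end.

Fixpoint fren (r : nat -> nat) (p : formula) : formula :=
  match p with
  | Eq t u => Eq (tren r t) (tren r u)
  | Neg p => Neg (fren r p)
  | And p q => And (fren r p) (fren r q)
  | Ex p => Ex (fren r p)
  end.

Lemma eval_tren r F v t : eval F v (tren r t) = eval (F \o r) v t.
Proof. by elim: t => //= [t ->|t -> u ->|t -> u ->|i t ->]. Qed.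

Lemma sat_fren r F v p : sat F v (fren r p) <-> sat (F \o r) v p.
Proof.
elim: p v => [t u|p IH|p IHp q IHq|p IH] v /=.
- by rewrite !eval_tren.
- by rewrite IH.
- by rewrite IHp IHq.
- by split=> -[n] /IH; exists n.
Qed.

Definition renl (i : nat) : nat := i.*2.
Definition renr (i : nat) : nat := if i is j.+1 then j.*2.+1 else 0.

Lemma sat_merge (F1 F2 : nat -> baire) : F1 0 = F2 0 ->
  exists G, [/\ G 0 = F1 0, G \o renl = F1 & G \o renr = F2].
Proof.
move=> F12; exists (fun j => if odd j then F2 j./2.+1 else F1 j./2).
split=> //; apply/funext => i /=.
  by rewrite /renl odd_double doubleK.
by case: i => [|i] //=; rewrite odd_double /= uphalf_double.
Qed.

Lemma Sigma11T : Sigma11 setT.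
Proof.
exists (Eq Zero Zero); apply/seteqP; split=> x //= _.
by exists (fun=> x).
Qed.

Lemma Sigma110 : Sigma11 set0.
Proof.
by exists (Neg (Eq Zero Zero)); apply/seteqP; split=> x //= [F _]; exact.
Qed.

Lemma Sigma11I A B : Sigma11 A -> Sigma11 B -> Sigma11 (A `&` B).
Proof.
move=> [p ->] [q ->]; exists (And (fren renl p) (fren renr q)).
apply/seteqP; split=> x /=.
  move=> [[F1 F1x sp] [F2 F2x sq]].
  have [|G [G0 Gl Gr]] := @sat_merge F1 F2; first by rewrite F1x.
  exists G; first by rewrite G0.
  by rewrite !sat_fren Gl Gr.
by move=> [G Gx] [/sat_fren sp /sat_fren sq]; split;
  [exists (G \o renl)|exists (G \o renr)].
Qed.

Lemma Sigma11U A B : Sigma11 A -> Sigma11 B -> Sigma11 (A `|` B).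
Proof.
move=> [p ->] [q ->].
exists (Neg (And (Neg (fren renl p)) (Neg (fren renr q)))).
apply/seteqP; split=> x /=.
  move=> [] [F Fx sF].
    have [//|G [G0 Gl Gr]] := @sat_merge F F.
    exists G; first by rewrite G0.
    by move=> [+ _]; rewrite sat_fren Gl.
  have [//|G [G0 Gl Gr]] := @sat_merge F F.
  exists G; first by rewrite G0.
  by move=> [_]; rewrite sat_fren Gr.
move=> [G Gx]; rewrite !sat_fren => /not_andP[] /contrapT s.
  by left; exists (G \o renl).
by right; exists (G \o renr).
Qed.

Lemma Delta11T : Delta11 setT.
Proof. by split; [exact: Sigma11T|rewrite setCT; exact: Sigma110]. Qed.

Lemma Delta11I A B : Delta11 A -> Delta11 B -> Delta11 (A `&` B).
Proof.
move=> [A1 A2] [B1 B2]; split; first exact: Sigma11I.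
by rewrite setCI; exact: Sigma11U.
Qed.

(* [delta_top] and [sigma_delta_top] are copies of the Baire space carrying
   the Delta-topology and the SigmaDelta-topology. *)
Definition delta_top : Type := baire.

Lemma Delta11_cover : \bigcup_(A in Delta11) A = setT.
Proof. by apply/seteqP; split=> // x _; exists setT => //; exact: Delta11T. Qed.

Lemma Delta11_join (A B : set baire) (x : baire) :
  Delta11 A -> Delta11 B -> A x -> B x ->
  exists C, [/\ Delta11 C, C x & C `<=` A `&` B].
Proof. by move=> dA dB Ax Bx; exists (A `&` B); split=> //; exact: Delta11I. Qed.

HB.instance Definition _ := Choice.copy delta_top (nat -> nat).
HB.instance Definition _ :=
  @isBaseTopological.Build delta_top (set baire) Delta11 id
    Delta11_cover Delta11_join.

Definition sigma_delta_base (A : set baire) : Prop :=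
  Sigma11 A /\ closed (A : set delta_top).

Definition sigma_delta_top : Type := baire.

Lemma sigma_delta_cover : \bigcup_(A in sigma_delta_base) A = setT.
Proof.
apply/seteqP; split=> // x _; exists setT => //.
by split; [exact: Sigma11T|exact: closedT].
Qed.

Lemma sigma_delta_join (A B : set baire) (x : baire) :
  sigma_delta_base A -> sigma_delta_base B -> A x -> B x ->
  exists C, [/\ sigma_delta_base C, C x & C `<=` A `&` B].
Proof.
move=> [sA cA] [sB cB] Ax Bx; exists (A `&` B); split=> //.
by split; [exact: Sigma11I|exact: (@closedI delta_top)].
Qed.

HB.instance Definition _ := Choice.copy sigma_delta_top (nat -> nat).
HB.instance Definition _ :=
  @isBaseTopological.Build sigma_delta_top (set baire) sigma_delta_base id
    sigma_delta_cover sigma_delta_join.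

(* An arbitrary topology on the Baire space is a structure
   [Tc : Topological baire], bundled as [Topological.Pack Tc]. *)
Definition effective_topology (Tc : Topological baire) : Prop :=
  exists2 B : set (set baire), @basis (Topological.Pack Tc) B & B `<=` Sigma11.

(* Main.v *)
(* Fix a regular effective topology, a basic open neighbourhood U of x and a
   basic open W with x in W and closure of W inside U. Every point outside the
   closure of W lies in a Sigma^1_1 set disjoint from W, so it suffices to put W
   inside a Sigma^1_1, Delta-closed set [delta_hull] that misses every Sigma^1_1
   set disjoint from W.

   Write each Sigma^1_1 set S_n as the set of y for which a transition system
   T_n(y), arithmetical in y and uniform in n, has an infinite run from 0 (its
   states are finite approximations to a truth valuation for the formula with
   code n). If S_n and W = S_w are disjoint, at each y one of T_n(y), T_w(y) is
   well founded, and then "T_n(y) simulates T_w(y)" and "some successor of the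
   root of T_w(y) simulates T_n(y)" are complementary. Both are Sigma^1_1, so
   they define a Delta^1_1 set separating S_n from W. The hull is the set of y
   such that, for every n, either S_n meets W or the second relation holds; as
   the second relation is uniformly Sigma^1_1 in n, so is the hull. *)

Require Import Defs.
From HB Require Import structures.
From mathcomp Require Import all_boot all_order all_classical.
From mathcomp Require Import topology.
From mathcomp Require Import zify.

Set Implicit Arguments.
Unset Strict Implicit.
Unset Printing Implicit Defensive.

Local Open Scope classical_set_scope.

(** * Coding of pairs and sequences *)

(* A pairing given by a term of the language; it is injective but not onto. *)
Definition pr (a b : nat) : nat := (a + b) * (a + b) + a.

(** The value lies in the interval from the square of [a + b] up to the next square, which
    determines the sum. *)
Lemma pr_inj a b c d : pr a b = pr c d -> a = c /\ b = d.
Proof.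
rewrite /pr => e; suff: a + b = c + d by nia.
by case: (ltngtP (a + b) (c + d)) => // h; nia.
Qed.

Lemma leq_pr a b : a <= pr a b /\ b <= pr a b. Proof. rewrite /pr; nia. Qed.

Definition unpr (z : nat) : nat * nat := xget (0, 0) [set p | pr p.1 p.2 = z].
Definition lpr z := (unpr z).1.
Definition rpr z := (unpr z).2.

Lemma unprK a b : unpr (pr a b) = (a, b).
Proof.
by rewrite /unpr; case: xgetP => [[c d] _ /= /pr_inj[-> ->]|/(_ (a, b))/=[]].
Qed.
Lemma lprK a b : lpr (pr a b) = a. Proof. by rewrite /lpr unprK. Qed.
Lemma rprK a b : rpr (pr a b) = b. Proof. by rewrite /rpr unprK. Qed.

Lemma unpr0 u : (forall a b, u <> pr a b) -> unpr u = (0, 0).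
Proof. by move=> h; rewrite /unpr; case: xgetP => // -[a b] _ /= /esym /h. Qed.

Lemma leq_unpr u : lpr u <= u /\ rpr u <= u.
Proof.
case: (pselect (exists p, u = pr p.1 p.2)) => [[[a b] ->]|h].
  by rewrite lprK rprK; exact: leq_pr.
by rewrite /lpr /rpr unpr0// => a b e; apply: h; exists (a, b).
Qed.

(* [nth_pr (pr i s)] is the i-th entry of the list [pr a0 (pr a1 ...)] coded
   by [s]; since [pr 0 0 = 0], every list is padded with zeros. *)
Definition nth_pr (u : nat) : nat := lpr (iter (lpr u) rpr (rpr u)).

Lemma nth_prE i s : nth_pr (pr i s) = lpr (iter i rpr s).
Proof. by rewrite /nth_pr lprK rprK. Qed.

Lemma nth_pr0 a b : nth_pr (pr 0 (pr a b)) = a.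
Proof. by rewrite nth_prE/= lprK. Qed.

Lemma nth_prS i a b : nth_pr (pr i.+1 (pr a b)) = nth_pr (pr i b).
Proof. by rewrite !nth_prE iterSr rprK. Qed.

(** Recursion equations characterizing [nth_pr], whose definition is not a term of the language; the
    first two clauses fix the values at non-codes. *)
Definition is_nth (N : baire) : Prop :=
  (forall u, (forall i s, u <> pr i s) -> N u = 0) /\
  (forall i s, (forall a b, s <> pr a b) -> N (pr i s) = 0) /\
  (forall a b, N (pr 0 (pr a b)) = a) /\
  (forall i a b, N (pr i.+1 (pr a b)) = N (pr i b)).

Lemma rpr_iter0 i : lpr (iter i rpr 0) = 0.
Proof.
have e : unpr 0 = (0, 0) := unprK 0 0.
have -> : iter i rpr 0 = 0 by elim: i => //= i ->; rewrite /rpr e.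
by rewrite /lpr e.
Qed.

Lemma is_nthP N : is_nth N <-> N = nth_pr.
Proof.
split=> [[N1 [N2 [N3 N4]]]|->].
  apply/funext => u; case: (pselect (exists p, u = pr p.1 p.2)) => [[[i s] /= ->]|h].
    elim: i s => [|i IH] s;
      (case: (pselect (exists p, s = pr p.1 p.2)) => [[[a b] /= ->]|hs];
      last (rewrite N2; last by move=> a b e; apply: hs; exists (a, b))).
    + by rewrite N3 nth_pr0.
    + rewrite nth_prE /= /lpr unpr0// => a b e; apply: hs; by exists (a, b).
    + by rewrite N4 nth_prS.
    + rewrite nth_prE iterSr {2}/rpr unpr0 ?rpr_iter0// => a b e; apply: hs.
      by exists (a, b).
  have h' i s : u <> pr i s by move=> e; apply: h; exists (i, s).
  by rewrite N1// /nth_pr {2}/lpr {2}/rpr unpr0//= /lpr (unprK 0 0).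
split=> [u h|]; first by rewrite /nth_pr {2}/lpr {2}/rpr unpr0//= /lpr (unprK 0 0).
split=> [i s h|]; last by split=> *; rewrite ?nth_pr0 ?nth_prS.
rewrite nth_prE; case: i => [|i]; first by rewrite /lpr unpr0.
by rewrite iterSr {2}/rpr unpr0 ?rpr_iter0.
Qed.

Lemma nth_pr_exists (g : baire) k : exists s, forall i, i < k -> nth_pr (pr i s) = g i.
Proof.
elim: k g => [|k IH] g; first by exists 0.
have [s hs] := IH (g \o S); exists (pr (g 0) s) => -[|i] ik.
  by rewrite nth_pr0.
by rewrite nth_prS hs.
Qed.

(** * Simulations of transition systems *)

Definition simulation (R R' Z : nat -> nat -> Prop) : Prop :=
  forall s t s', Z s t -> R s s' -> exists t', R' t t' /\ Z s' t'.

Definition simulates (R R' : nat -> nat -> Prop) (s t : nat) : Prop :=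
  exists Z, simulation R R' Z /\ Z s t.

Definition terminates (R : nat -> nat -> Prop) : nat -> Prop :=
  Acc (fun t s => R s t).

Lemma simulates_step R R' s t s' : simulates R R' s t -> R s s' ->
  exists t', R' t t' /\ simulates R R' s' t'.
Proof.
move=> [Z [sZ Zst]] Rs; have [t' [Rt Zt]] := sZ _ _ _ Zst Rs.
by exists t'; split=> //; exists Z.
Qed.

Lemma simulates_intro R R' s t :
  (forall s', R s s' -> exists t', R' t t' /\ simulates R R' s' t') ->
  simulates R R' s t.
Proof.
move=> h; exists (fun a b => simulates R R' a b \/ (a = s /\ b = t)); split; last by right.
move=> a b a' [sab|[-> ->]] Ra.
  by have [t' [Rt st]] := simulates_step sab Ra; exists t'; split=> //; left.
by have [t' [Rt st]] := h _ Ra; exists t'; split=> //; left.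
Qed.

Lemma simulates_trans R1 R2 R3 a b c :
  simulates R1 R2 a b -> simulates R2 R3 b c -> simulates R1 R3 a c.
Proof.
move=> ab bc; exists (fun x z => exists2 y, simulates R1 R2 x y & simulates R2 R3 y z).
split; last by exists b.
move=> x z x' [y xy yz] Rx.
have [y' [Ry xy']] := simulates_step xy Rx.
have [z' [Rz yz']] := simulates_step yz Ry.
by exists z'; split=> //; exists y'.
Qed.

Lemma terminates_simulated R R' s t :
  simulates R R' s t -> terminates R' t -> terminates R s.
Proof.
move=> st At; elim: At s st => {}t _ IH s st.
by constructor=> s' Rs; have [t' [Rt st']] := simulates_step st Rs; apply: IH Rt _ st'.
Qed.

(** Otherwise the rank of [s] would be at most that of its successor [s']. *)
Lemma simulates_next_nonterminating R s s' :
  R s s' -> simulates R R s s' -> ~ terminates R s.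
Proof.
move=> Rs ss As; elim: As s' Rs ss => {}s _ IH s' Rs ss.
by have [t [Rt st]] := simulates_step ss Rs; exact: IH Rs _ Rt st.
Qed.

(* For well-founded trees: rank T <= rank T' fails only if rank T' < rank T. *)
Lemma not_simulates R R' s t : terminates R s \/ terminates R' t ->
  ~ simulates R R' s t -> exists s', R s s' /\ simulates R' R t s'.
Proof.
(* Shared by both inductions: the witness is a move [a'] that no [b'] answers, and the hypothesis at
   each pair [a'], [b'] supplies the answer to [b']. *)
have step a b : (forall a' b', R a a' -> R' b b' -> ~ simulates R R' a' b' ->
      exists a'', R a' a'' /\ simulates R' R b' a'') ->
    ~ simulates R R' a b -> exists a', R a a' /\ simulates R' R b a'.
  move=> IH nsim; apply: contrapT => h; apply/nsim/simulates_intro => a' Ra.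
  apply: contrapT => h'; apply: h; exists a'; split=> //.
  apply: simulates_intro => b' Rb; apply: IH => // sab.
  by apply: h'; exists b'.
move=> [As|At]; first by elim: As t => {}s _ IH t; apply: step => a' b' Ra _; exact: IH.
by elim: At s => {}t _ IH s; apply: step => a' b' _ Rb; exact: IH.
Qed.

Lemma nonterminating_run R s : ~ terminates R s ->
  exists f : nat -> nat, f 0 = s /\ forall k, R (f k) (f k.+1).
Proof.
move=> ns.
have next p : exists q, ~ terminates R p -> R p q /\ ~ terminates R q.
  case: (pselect (exists q, R p q /\ ~ terminates R q)) => [[q h]|h].
    by exists q.
  exists 0; case; constructor=> q Rq; apply: contrapT => nq; apply: h.
  by exists q.
have [g hg] := choice next.
have nt k : ~ terminates R (iter k g s) by elim: k => //= k /hg[].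
by exists (fun k => iter k g s); split=> // k; have [] := hg _ (nt k).
Qed.
(** * Arithmetical predicates *)

(** Definability is stated semantically, so that it follows from closure properties without writing
    formulas out. *)
Definition term_def (t : (nat -> baire) -> (nat -> nat) -> nat) : Prop :=
  exists u, forall F v, Defs.eval F v u = t F v.

Definition arithmetical (P : (nat -> baire) -> (nat -> nat) -> Prop) : Prop :=
  exists p, forall F v, sat F v p <-> P F v.

Lemma term_def_var i : term_def (fun F v => v i).
Proof. by exists (Var i). Qed.

Lemma term_def_const c : term_def (fun F v => c).
Proof. by exists (iter c Succ Zero) => F v; elim: c => //= c ->. Qed.

Lemma term_def_succ t : term_def t -> term_def (fun F v => (t F v).+1).
Proof. by move=> [u hu]; exists (Succ u) => F v /=; rewrite hu. Qed.

Lemma term_def_app i t : term_def t -> term_def (fun F v => F i (t F v)).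
Proof. by move=> [u hu]; exists (App i u) => F v /=; rewrite hu. Qed.

Lemma term_def_add t t' : term_def t -> term_def t' ->
  term_def (fun F v => t F v + t' F v).
Proof. by move=> [u hu] [u' hu']; exists (Add u u') => F v /=; rewrite hu hu'. Qed.

Lemma term_def_mul t t' : term_def t -> term_def t' ->
  term_def (fun F v => t F v * t' F v).
Proof. by move=> [u hu] [u' hu']; exists (Mul u u') => F v /=; rewrite hu hu'. Qed.

Lemma term_def_pr t t' : term_def t -> term_def t' ->
  term_def (fun F v => pr (t F v) (t' F v)).
Proof.
by move=> ht ht'; apply: term_def_add => //; apply: term_def_mul; apply: term_def_add.
Qed.

Lemma arithmetical_eq t t' : term_def t -> term_def t' ->
  arithmetical (fun F v => t F v = t' F v).
Proof. by move=> [u hu] [u' hu']; exists (Eq u u') => F v /=; rewrite hu hu'. Qed.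

Lemma arithmetical_not P : arithmetical P -> arithmetical (fun F v => ~ P F v).
Proof. by move=> [p hp]; exists (Neg p) => F v /=; rewrite hp. Qed.

Lemma arithmetical_and P Q : arithmetical P -> arithmetical Q ->
  arithmetical (fun F v => P F v /\ Q F v).
Proof. by move=> [p hp] [q hq]; exists (And p q) => F v /=; rewrite hp hq. Qed.

(** In the premise the bound variable is [v 0] and the outer ones are shifted, as under [scons]. *)
Lemma arithmetical_ex (Q : (nat -> baire) -> (nat -> nat) -> nat -> Prop) :
  arithmetical (fun F v => Q F (fun i => v i.+1) (v 0)) ->
  arithmetical (fun F v => exists n, Q F v n).
Proof.
by move=> [q hq]; exists (Ex q) => F v /=; split=> -[n h]; exists n;
  apply/(hq F (scons n v)).
Qed.

Lemma eq_arithmetical P Q : (forall F v, P F v <-> Q F v) ->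
  arithmetical P -> arithmetical Q.
Proof. by move=> PQ [p hp]; exists p => F v; rewrite hp. Qed.

Lemma arithmetical_or P Q : arithmetical P -> arithmetical Q ->
  arithmetical (fun F v => P F v \/ Q F v).
Proof.
move=> hP hQ; apply: (eq_arithmetical (P := fun F v => ~ (~ P F v /\ ~ Q F v))).
  by move=> F v; rewrite not_andP !notK.
by apply: arithmetical_not; apply: arithmetical_and; exact: arithmetical_not.
Qed.

Lemma arithmetical_imp P Q : arithmetical P -> arithmetical Q ->
  arithmetical (fun F v => P F v -> Q F v).
Proof.
move=> hP hQ; apply: (eq_arithmetical (P := fun F v => ~ P F v \/ Q F v)).
  by move=> F v; rewrite implyE.
by apply: arithmetical_or => //; exact: arithmetical_not.
Qed.

Lemma arithmetical_iff P Q : arithmetical P -> arithmetical Q ->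
  arithmetical (fun F v => P F v <-> Q F v).
Proof. by move=> hP hQ; apply: arithmetical_and; exact: arithmetical_imp. Qed.

Lemma arithmetical_all (Q : (nat -> baire) -> (nat -> nat) -> nat -> Prop) :
  arithmetical (fun F v => Q F (fun i => v i.+1) (v 0)) ->
  arithmetical (fun F v => forall n, Q F v n).
Proof.
move=> hQ; apply: (eq_arithmetical (P := fun F v => ~ exists n, ~ Q F v n)).
  by move=> F v; rewrite -forallNE; split=> h n; have := h n; rewrite notK.
by apply/arithmetical_not/arithmetical_ex/arithmetical_not.
Qed.

Lemma arithmetical_lt t t' : term_def t -> term_def t' ->
  arithmetical (fun F v => t F v < t' F v).
Proof.
move=> [u hu] [u' hu'].
(* [w] shifts number variables past the new quantifier over the difference. *)
pose w := fix w (t : term) := match t with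
  | Var i => Var i.+1 | Zero => Zero | Succ t => Succ (w t)
  | Add a b => Add (w a) (w b) | Mul a b => Mul (w a) (w b) | App i t => App i (w t) end.
have ew F v n x : Defs.eval F (scons n v) (w x) = Defs.eval F v x.
  by elim: x => //= [t0 ->|a -> b ->|a -> b ->|i a ->].
exists (Ex (Eq (Add (w u) (Succ (Var 0))) (w u'))) => F v /=.
split=> [[n]|h]; first by rewrite !ew hu hu'; lia.
by exists (t' F v - (t F v).+1); rewrite !ew hu hu'; lia.
Qed.

Ltac arith := cbv beta;
  lazymatch goal with
  | |- arithmetical (fun F v => ~ _) => apply: arithmetical_not
  | |- arithmetical (fun F v => _ /\ _) => apply: arithmetical_and
  | |- arithmetical (fun F v => _ \/ _) => apply: arithmetical_or
  | |- arithmetical (fun F v => _ <-> _) => apply: arithmetical_iff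
  | |- arithmetical (fun F v => exists _, _) => apply: arithmetical_ex
  | |- arithmetical (fun F v => _ = _) => apply: arithmetical_eq
  | |- arithmetical (fun F v => is_true (_ < _)) => apply: arithmetical_lt
  | |- arithmetical (fun F v => forall _ : nat, _) => apply: arithmetical_all
  | |- arithmetical (fun F v => _ -> _) => apply: arithmetical_imp
  | |- term_def (fun F v => _.+1) => apply: term_def_succ
  | |- term_def (fun F v => _ + _) => apply: term_def_add
  | |- term_def (fun F v => _ * _) => apply: term_def_mul
  | |- term_def (fun F v => pr _ _) => apply: term_def_pr
  | |- term_def (fun F v => v ?i) => exact: (term_def_var i)
  | |- term_def (fun F v => F ?i _) => apply: (term_def_app i)
  | |- term_def (fun F v => ?c) => exact: (term_def_const c)
  end.

Lemma arithmetical_is_nth i : arithmetical (fun F v => is_nth (F i)).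
Proof. rewrite /is_nth; repeat arith. Qed.

(** Conjoining [is_nth] to the matrix pins function variable 1, so the matrix may decode
    sequences. *)
Lemma Sigma11_arithmetical (P : (nat -> baire) -> Prop) :
  arithmetical (fun F v => P F) ->
  Sigma11 [set y | exists F : nat -> baire, [/\ F 0 = y, F 1 = nth_pr & P F]].
Proof.
move=> hP; have [p hp] := arithmetical_and (arithmetical_is_nth 1) hP.
exists p; apply/seteqP; split=> y /= => [[F [F0 F1 PF]]|[F F0 /hp[/is_nthP F1 PF]]].
  by exists F => //; apply/hp; split=> //; apply/is_nthP.
by exists F.
Qed.

(** * A universal Sigma^1_1 set *)

(* An expression code is [pr tag m]; [pr 0 i] is the i-th function variable,
   tags 1 to 7 are below. Formulas are expressions too, a nonzero value meaning
   true, and the value of [ex_code a] is 0 or the successor of a witness. *)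
Definition num_code i := pr 1 i.
Definition var_code i := pr 2 i.
Definition comp_code a b := pr 3 (pr a b).
Definition add_code a b := pr 4 (pr a b).
Definition mul_code a b := pr 5 (pr a b).
Definition eq_code a b := pr 6 (pr a b).
Definition ex_code a := pr 7 a.

(* [val n e x]: the expression with code [n] has value [x] in the environment
   coded by [e]. Since [val] occurs only negatively, the clauses pass to partial
   approximations of [val] and to increasing unions of these. *)
Definition evaluation (N : baire) (val : nat -> nat -> nat -> Prop) : Prop :=
  (forall i e x, val (num_code i) e x -> x = i) /\
  (forall i e x, val (var_code i) e x -> x = N (pr i e)) /\
  (forall a b e x y z, val b e x -> val a x y -> val (comp_code a b) e z -> z = y) /\
  (forall a b e x y z, val a e x -> val b e y -> val (add_code a b) e z -> z = x + y) /\
  (forall a b e x y z, val a e x -> val b e y -> val (mul_code a b) e z -> z = x * y) /\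
  (forall a b e x y z, val a e x -> val b e y -> val (eq_code a b) e z ->
     (z <> 0 <-> x = y)) /\
  (forall a e n x, val (ex_code a) e n.+1 -> val a (pr n e) x -> x <> 0) /\
  (forall a e n x z, val a (pr n e) x -> x <> 0 -> val (ex_code a) e z -> z <> 0).

Definition accepting (N y : baire) (m : nat) (val : nat -> nat -> nat -> Prop) : Prop :=
  evaluation N val /\ (forall e x, val (pr 0 0) e x -> x = y e) /\
  (forall x, val m 0 x -> x <> 0).

Definition graph (V : baire) (n e x : nat) : Prop := V (pr n e) = x.

Definition universal (m : nat) : set baire :=
  [set y | exists V, accepting nth_pr y m (graph V)].

(* The approximation to [graph V] by the first [k] values of [V], listed in [s]. *)
Definition approx (N : baire) (k s n e x : nat) : Prop :=
  pr n e < k /\ N (pr (pr n e) s) = x.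

(** A state [pr k s] lists [k] values; the root 0 is [pr 0 0], the empty list. *)
Definition extends (N y : baire) (m p q : nat) : Prop :=
  exists k s t, p = pr k s /\ q = pr k.+1 t /\
    (forall i, i < k -> N (pr i t) = N (pr i s)) /\
    accepting N y m (approx N k.+1 t).

Lemma accepting_sub N y m (val val' : nat -> nat -> nat -> Prop) :
  (forall n e x, val n e x -> val' n e x) ->
  accepting N y m val' -> accepting N y m val.
Proof.
move=> sub [[c1 [c2 [c3 [c4 [c5 [c6 [c7 c8]]]]]]] [c9 c10]].
do ! apply: conj; eauto.
Qed.

Lemma accepting_lim N y m (val : nat -> nat -> nat -> nat -> Prop) :
  (forall k l n e x, k <= l -> val k n e x -> val l n e x) ->
  (forall k, accepting N y m (val k)) ->
  accepting N y m (fun n e x => exists k, val k n e x).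
Proof.
move=> mono acc.
(* Each clause involves at most three values, which all appear at a common stage. *)
have up2 k k' n e x n' e' x' : val k n e x -> val k' n' e' x' ->
    exists l, val l n e x /\ val l n' e' x'.
  move=> h h'; exists (maxn k k').
  by split; [apply: mono h|apply: mono h']; rewrite ?leq_maxl ?leq_maxr.
have up3 k k' k'' n e x n' e' x' n'' e'' x'' :
    val k n e x -> val k' n' e' x' -> val k'' n'' e'' x'' ->
    exists l, [/\ val l n e x, val l n' e' x' & val l n'' e'' x''].
  move=> h h' /(up2 _ _ _ _ _ _ _ _ h')[l [{}h' h'']]; exists (maxn k l).
  by split; [apply: mono h|apply: mono h'|apply: mono h'']; rewrite ?leq_maxl ?leq_maxr.
do ! apply: conj.
- by move=> i e x [k h]; have [[c _] _] := acc k; exact: c h.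
- by move=> i e x [k h]; have [[_ [c _]] _] := acc k; exact: c h.
- move=> a b e x z w [k h] [k' h'] [k'' /(up3 _ _ _ _ _ _ _ _ _ _ _ _ h h')[l [{}h {}h' h'']]].
  by have [[_ [_ [c _]]] _] := acc l; exact: c h h' h''.
- move=> a b e x z w [k h] [k' h'] [k'' /(up3 _ _ _ _ _ _ _ _ _ _ _ _ h h')[l [{}h {}h' h'']]].
  by have [[_ [_ [_ [c _]]]] _] := acc l; exact: c h h' h''.
- move=> a b e x z w [k h] [k' h'] [k'' /(up3 _ _ _ _ _ _ _ _ _ _ _ _ h h')[l [{}h {}h' h'']]].
  by have [[_ [_ [_ [_ [c _]]]]] _] := acc l; exact: c h h' h''.
- move=> a b e x z w [k h] [k' h'] [k'' /(up3 _ _ _ _ _ _ _ _ _ _ _ _ h h')[l [{}h {}h' h'']]].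
  by have [[_ [_ [_ [_ [_ [c _]]]]]] _] := acc l; exact: c h h' h''.
- move=> a e n x [k h] [k' /(up2 _ _ _ _ _ _ _ _ h)[l [{}h h']]].
  by have [[_ [_ [_ [_ [_ [_ [c _]]]]]]] _] := acc l; exact: c h h'.
- move=> a e n x z [k h] xn [k' /(up2 _ _ _ _ _ _ _ _ h)[l [{}h h']]].
  by have [[_ [_ [_ [_ [_ [_ [_ c]]]]]]] _] := acc l; exact: c h xn h'.
- by move=> e x [k h]; have [_ [c _]] := acc k; exact: c h.
- by move=> x [k h]; have [_ [_ c]] := acc k; exact: c h.
Qed.

(** Initial segments of a valuation form an infinite run; conversely, the limit of a run is a
    valuation. *)
Lemma universalP m y : universal m y <-> ~ terminates (extends nth_pr y m) 0.
Proof.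
split=> [[V acc]|].
  have run p : terminates (extends nth_pr y m) p -> forall k s, p = pr k s ->
      ~ (forall i, i < k -> nth_pr (pr i s) = V i).
    elim=> {}p _ IH k s ep hs.
    have [t ht] := nth_pr_exists V k.+1.
    apply: (IH (pr k.+1 t) _ k.+1 t (erefl _) ht); exists k, s, t; split=> //; split=> //.
    split=> [i ik|]; first by rewrite ht ?hs// ltnW.
    by apply: accepting_sub acc => n e x [lt <-]; rewrite /graph ht.
  by move=> t0; apply: (run 0 t0 0 0 erefl).
move=> /nonterminating_run[f [f0 step]].
have state k : exists s, f k = pr k s.
  elim: k => [|k [s fk]]; first by exists 0.
  have [k' [s' [t [e [e' _]]]]] := step k.
  by move: e; rewrite fk => /pr_inj[ek _]; exists t; rewrite e' ek.
have [s fs] := choice state.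
have ext k : (forall i, i < k -> nth_pr (pr i (s k.+1)) = nth_pr (pr i (s k))) /\
    accepting nth_pr y m (approx nth_pr k.+1 (s k.+1)).
  have [k' [s' [t [+ [+ h]]]]] := step k.
  by rewrite !fs => /pr_inj[ek es] /pr_inj[_ et]; move: h; rewrite -ek -es -et.
have stable i k : i < k -> nth_pr (pr i (s k)) = nth_pr (pr i (s i.+1)).
  elim: k => // k IH; rewrite ltnS leq_eqVlt => /predU1P[->//|ik].
  by rewrite (proj1 (ext k)) // IH.
(* Stage [i.+1] is the first to list entry [i], which is constant from there on. *)
exists (fun i => nth_pr (pr i (s i.+1))).
pose val k n e x := approx nth_pr k.+1 (s k.+1) n e x.
apply: (@accepting_sub _ _ _ _ (fun n e x => exists k, val k n e x)).
  by move=> n e x <-; exists (pr n e); split.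
apply: accepting_lim => [k l n e x kl [lt <-]|k]; last by have [] := ext k.
by split; [exact: leq_trans lt _|rewrite !stable// (leq_trans lt)].
Qed.

(** * Coding of terms and formulas, and their evaluation *)

Fixpoint term_code (t : term) : nat :=
  match t with
  | Var i => var_code i
  | Zero => num_code 0
  | Succ t => add_code (term_code t) (num_code 1)
  | Add t u => add_code (term_code t) (term_code u)
  | Mul t u => mul_code (term_code t) (term_code u)
  | App i t => comp_code (pr 0 i) (term_code t)
  end.

(** With truth read as a nonzero value, negation is equality with 0 and conjunction is a product. *)
Fixpoint formula_code (p : formula) : nat :=
  match p with
  | Eq t u => eq_code (term_code t) (term_code u)
  | Neg p => eq_code (formula_code p) (num_code 0)
  | And p q => mul_code (formula_code p) (formula_code q)
  | Ex p => ex_code (formula_code p)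
  end.

Definition valuation (e i : nat) : nat := nth_pr (pr i e).

Lemma valuation0 : valuation 0 = (fun=> 0).
Proof. by apply/funext => i; rewrite /valuation nth_prE rpr_iter0. Qed.

Lemma valuation_pr n e : valuation (pr n e) = scons n (valuation e).
Proof. by apply/funext => -[|i]; rewrite /valuation ?nth_pr0 ?nth_prS. Qed.

Section evaluation_codes.
Variables (V : baire) (evalV : evaluation nth_pr (graph V)).
Let F (i a : nat) := V (pr (pr 0 i) a).

Lemma eval_term_code t e : V (pr (term_code t) e) = Defs.eval F (valuation e) t.
Proof.
have [c1 [c2 [c3 [c4 [c5 _]]]]] := evalV.
elim: t => /= [i||t IH|t IHt u IHu|t IHt u IHu|i t IH].
- exact: c2 (erefl _).
- exact: c1 (erefl _).
- by rewrite (c4 _ _ _ _ _ _ IH (c1 _ _ _ erefl) erefl) addn1.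
- exact: c4 IHt IHu (erefl _).
- exact: c5 IHt IHu (erefl _).
- exact: c3 IH (erefl _) (erefl _).
Qed.

Lemma sat_formula_code p e : V (pr (formula_code p) e) <> 0 <-> sat F (valuation e) p.
Proof.
have [c1 [_ [_ [_ [c5 [c6 [c7 c8]]]]]]] := evalV.
elim: p e => /= [t u|p IH|p IHp q IHq|p IH] e.
- exact: (c6 _ _ _ _ _ _ (eval_term_code t e) (eval_term_code u e) erefl).
- by rewrite (c6 _ _ _ _ _ _ erefl (c1 0 e _ erefl) erefl) -IH notK.
- rewrite (c5 _ _ _ _ _ _ erefl erefl erefl) -IHp -IHq.
  split=> [/eqP|[/eqP x0 /eqP y0]]; first by rewrite muln_eq0 negb_or => /andP[/eqP ? /eqP].
  by apply/eqP; rewrite muln_eq0 negb_or x0.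
- split=> [|[n]]; last by rewrite -valuation_pr => /IH h; exact: c8 erefl h erefl.
  case E : (V _) => [|n] // _; exists n; rewrite -valuation_pr -IH.
  exact: c7 E erefl.
Qed.

End evaluation_codes.

(* The fuel [k] only has to exceed the code [n]. *)
Fixpoint interpret (F : nat -> baire) (k n e : nat) : nat :=
  if k is k'.+1 then
    let m := rpr n in let a := lpr m in let b := rpr m in
    match lpr n with
    | 0 => F m e
    | 1 => m
    | 2 => nth_pr (pr m e)
    | 3 => interpret F k' a (interpret F k' b e)
    | 4 => interpret F k' a e + interpret F k' b e
    | 5 => interpret F k' a e * interpret F k' b e
    | 6 => interpret F k' a e == interpret F k' b e
    | 7 => xget 0 [set x | exists2 z, x = z.+1 & interpret F k' m (pr z e) <> 0]
    | _ => 0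
    end
  else 0.

Lemma interpret_fuel F k l n : n < k -> n < l -> interpret F k n = interpret F l n.
Proof.
elim: k l n => // k IH [//|l] n nk nl; apply/funext => e /=.
have [le1 le2] := leq_unpr (rpr n).
have [lt|] := ltnP (rpr n) n.
  by rewrite !(IH l); [|lia..].
(* [rpr n] can fail to be smaller than [n] only at tag 0, where there is no recursive call. *)
move=> nle; suff -> : lpr n = 0 by [].
case: (pselect (exists p, n = pr p.1 p.2)) => [[[a b] /= en]|h].
  by move: nle; rewrite en lprK rprK /pr; nia.
by rewrite /lpr unpr0// => a b en; apply: h; exists (a, b).
Qed.

(** [V] is obtained by recursion on codes; it need not be effective, as it is only quantified
    over. *)
Lemma evaluation_exists (F : nat -> baire) : exists V : baire,
  evaluation nth_pr (graph V) /\ forall i e, V (pr (pr 0 i) e) = F i e.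
Proof.
pose W n := interpret F n.+1 n.
have WE t m e : W (pr t m) e = match t with
    | 0 => F m e
    | 1 => m
    | 2 => nth_pr (pr m e)
    | 3 => W (lpr m) (W (rpr m) e)
    | 4 => W (lpr m) e + W (rpr m) e
    | 5 => W (lpr m) e * W (rpr m) e
    | 6 => W (lpr m) e == W (rpr m) e
    | 7 => xget 0 [set x | exists2 z, x = z.+1 & W m (pr z e) <> 0]
    | _ => 0
    end.
  have fuel a : 0 < t -> a <= m -> interpret F (pr t m) a = W a.
    by move=> t0 am; apply: interpret_fuel => //; rewrite /pr; nia.
  have [lm rm] := leq_unpr m.
  have -> k : W k e = let m := rpr k in let a := lpr m in let b := rpr m in
      match lpr k with
      | 0 => F m e
      | 1 => m
      | 2 => nth_pr (pr m e)
      | 3 => interpret F k a (interpret F k b e)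
      | 4 => interpret F k a e + interpret F k b e
      | 5 => interpret F k a e * interpret F k b e
      | 6 => interpret F k a e == interpret F k b e
      | 7 => xget 0 [set x | exists2 z, x = z.+1 & interpret F k m (pr z e) <> 0]
      | _ => 0
      end by [].
  cbv zeta; rewrite lprK rprK; case: t fuel => // t fuel.
  by rewrite !fuel.
exists (fun u => W (lpr u) (rpr u)); rewrite /graph.
split; last by move=> i e; rewrite !lprK !rprK WE.
do ! apply: conj.
- by move=> i e x; rewrite !(lprK, rprK, WE) => ->.
- by move=> i e x; rewrite !(lprK, rprK, WE) => ->.
- by move=> a b e x y z; rewrite !(lprK, rprK) WE !(lprK, rprK) => <- <- <-.
- by move=> a b e x y z; rewrite !(lprK, rprK) WE !(lprK, rprK) => <- <- <-.
- by move=> a b e x y z; rewrite !(lprK, rprK) WE !(lprK, rprK) => <- <- <-.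
- move=> a b e x y z; rewrite !(lprK, rprK) WE !(lprK, rprK) => <- <- <-.
  by case: eqP.
- move=> a e n x; rewrite !(lprK, rprK) WE => + <-.
  by case: xgetP => // z -> [m -> h] [<-].
- move=> a e n x z; rewrite !(lprK, rprK) WE => <- h <-.
  case: xgetP => [u -> [m ->]//|/(_ n.+1)]; case.
  by exists n.
Qed.

(** A valuation carries its own assignment, read off at the codes [pr 0 i], so a single function
    quantifier replaces the block. *)
Lemma universal_Sigma11 (A : set baire) : Sigma11 A -> exists m, A = universal m.
Proof.
move=> [p ->]; exists (formula_code p); apply/seteqP; split=> y /=.
  move=> [F <- sp]; have [V [evV VF]] := evaluation_exists F.
  exists V; split=> //; split=> [e x <-|x <-]; first exact: VF.
  apply/(sat_formula_code evV); rewrite valuation0.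
  suff -> : (fun i a => V (pr (pr 0 i) a)) = F by [].
  by apply/funext => i; apply/funext => a; exact: VF.
move=> [V [evV [V0 acc]]]; exists (fun i a => V (pr (pr 0 i) a)).
  by apply/funext => e; exact: V0 erefl.
by rewrite -valuation0; apply/(sat_formula_code evV)/acc.
Qed.
(** * Separation and the Delta-closure *)

Definition separator (w n : nat) : set baire := [set y |
  simulates (extends nth_pr y w) (extends nth_pr y n) 0 0].

Definition coseparator (w n : nat) : set baire := [set y | exists q,
  extends nth_pr y w 0 q /\
  simulates (extends nth_pr y n) (extends nth_pr y w) 0 q].

(** A relation is coded as the support of a function, which turns [exists Z] into a function
    quantifier. *)
Lemma simulatesP R R' s t : simulates R R' s t <->
  exists Z : baire, simulation R R' (fun a b => Z (pr a b) <> 0) /\ Z (pr s t) <> 0.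
Proof.
split=> [[Z [sZ Zst]]|[Z [sZ Zst]]]; last by exists (fun a b => Z (pr a b) <> 0).
exists (fun u => `[< Z (lpr u) (rpr u) >] : nat).
have E a b : `[< Z (lpr (pr a b)) (rpr (pr a b)) >] <> 0 :> nat <-> Z a b.
  by rewrite lprK rprK; case: asboolP.
split; last exact/E.
move=> a b a' /E Zab /(sZ _ _ _ Zab)[b' [Rb Zb]].
by exists b'; split=> //; apply/E.
Qed.

Ltac unfold_arith :=
  rewrite /accepting /extends /accepting /evaluation /approx /simulation
    /num_code /var_code /comp_code /add_code /mul_code /eq_code /ex_code.

Lemma Sigma11_separator w n : Sigma11 (separator w n).
Proof.
have -> : separator w n = [set y | exists F : nat -> baire,
    [/\ F 0 = y, F 1 = nth_pr &
     simulation (extends (F 1) (F 0) w) (extends (F 1) (F 0) n)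
       (fun a b => F 2 (pr a b) <> 0) /\ F 2 (pr 0 0) <> 0]].
  apply/seteqP; split=> y /=.
    move=> /simulatesP[Z hZ].
    (* Variables 0 and 1 are [y] and [nth_pr]; all later ones are [Z]. *)
    by exists (nth Z [:: y; nth_pr]); split.
  by move=> [F [<- -> hZ]]; apply/simulatesP; exists (F 2).
apply: Sigma11_arithmetical; unfold_arith; repeat arith.
Qed.

Lemma Sigma11_coseparator w n : Sigma11 (coseparator w n).
Proof.
have -> : coseparator w n = [set y | exists F : nat -> baire,
    [/\ F 0 = y, F 1 = nth_pr & exists q, extends (F 1) (F 0) w 0 q /\
     (simulation (extends (F 1) (F 0) n) (extends (F 1) (F 0) w)
       (fun a b => F 2 (pr a b) <> 0) /\ F 2 (pr 0 q) <> 0)]].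
  apply/seteqP; split=> y /=.
    move=> [q [ext /simulatesP[Z hZ]]].
    by exists (nth Z [:: y; nth_pr]); split=> //; exists q.
  move=> [F [<- -> [q [ext hZ]]]]; exists q; split=> //.
  by apply/simulatesP; exists (F 2).
apply: Sigma11_arithmetical; unfold_arith; repeat arith.
Qed.

Definition delta_hull (w : nat) : set baire := [set y | forall n,
  (universal n `&` universal w) !=set0 \/ coseparator w n y].

(** By choice the function quantifiers move in front of [forall n]: the section at [n] of variable 2
    is a common point, of 3 and 4 its two valuations, of 5 the simulation. *)
Lemma Sigma11_delta_hull w : Sigma11 (delta_hull w).
Proof.
have -> : delta_hull w = [set y | exists F : nat -> baire,
    [/\ F 0 = y, F 1 = nth_pr & forall n,
     (accepting (F 1) (fun e => F 2 (pr n e)) n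
        (fun i e x => F 3 (pr n (pr i e)) = x) /\
      accepting (F 1) (fun e => F 2 (pr n e)) w
        (fun i e x => F 4 (pr n (pr i e)) = x)) \/
     exists q, extends (F 1) (F 0) w 0 q /\
      (simulation (extends (F 1) (F 0) n) (extends (F 1) (F 0) w)
         (fun a b => F 5 (pr n (pr a b)) <> 0) /\ F 5 (pr n (pr 0 q)) <> 0)]].
  apply/seteqP; split=> y /=.
    move=> hy.
    have wit n : exists G : nat -> baire,
        (accepting nth_pr (G 0) n (graph (G 1)) /\
         accepting nth_pr (G 0) w (graph (G 2))) \/
        exists q, extends nth_pr y w 0 q /\
         (simulation (extends nth_pr y n) (extends nth_pr y w)
            (fun a b => G 3 (pr a b) <> 0) /\ G 3 (pr 0 q) <> 0).
      case: (hy n) => [[z [[V accV] [V' accV']]]|[q [ext /simulatesP[Z hZ]]]].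
        by exists (nth y [:: z; V; V']); left.
      by exists (fun=> Z); right; exists q.
    have [G hG] := choice wit.
    exists (fun i => match i with 0 => y | 1 => nth_pr
      | j.+2 => fun u => G (lpr u) j (rpr u) end).
    split=> // n.
    have GE i : (fun e => G (lpr (pr n e)) i (rpr (pr n e))) = G n i.
      by apply/funext => e; rewrite lprK rprK.
    case: (hG n) => [[acc acc']|[q [ext [sZ Z0]]]]; [left|right].
      by rewrite GE; split; [apply: accepting_sub acc|apply: accepting_sub acc'] => a b x <-;
        rewrite /graph lprK rprK.
    exists q; split=> //; split; last by rewrite lprK rprK.
    move=> a b a'; rewrite lprK rprK => Zab /(sZ _ _ _ Zab)[b' [Rb Zb]].
    by exists b'; rewrite lprK rprK.
  move=> [F [<- F1 hF]] n; rewrite F1 in hF.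
  case: (hF n) => [[acc acc']|[q [ext hZ]]]; [left|right].
    exists (fun e => F 2 (pr n e)).
    by split; [exists (fun u => F 3 (pr n u))|exists (fun u => F 4 (pr n u))].
  exists q; split=> //; apply/simulatesP.
  by exists (fun u => F 5 (pr n u)).
apply: Sigma11_arithmetical; unfold_arith; repeat arith.
Qed.

(** One of the two systems terminates. If both relations held, the root for [w] would be simulated
    by its own successor, so neither would terminate; if both failed, [not_simulates] would be
    contradicted. *)
Lemma separatorC w n y : ~ (universal n y /\ universal w y) ->
  separator w n y <-> ~ coseparator w n y.
Proof.
move=> nwn; have term : terminates (extends nth_pr y w) 0 \/
    terminates (extends nth_pr y n) 0.
  apply: contrapT => /not_orP[tw tn]; apply: nwn.
  by split; apply/universalP.
split=> [sep [q [ext cosep]]|ncosep].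
  have := simulates_next_nonterminating ext (simulates_trans sep cosep).
  by case: term => // tn; have := terminates_simulated sep tn.
by apply: contrapT => /(not_simulates term).
Qed.

Lemma Delta11_separator w n : (forall y, ~ (universal n y /\ universal w y)) ->
  Delta11 (separator w n).
Proof.
move=> nw; split; first exact: Sigma11_separator.
have -> : ~` separator w n = coseparator w n; last exact: Sigma11_coseparator.
apply/seteqP; split=> y /=; rewrite (separatorC (nw y)); first exact: contrapT.
by move=> cosep; apply.
Qed.

(** If [y] is not in [universal n], the system for [n] terminates and that for [w] does not, so the
    former cannot simulate the latter. *)
Lemma universal_sub_delta_hull w : universal w `<=` delta_hull w.
Proof.
move=> y /[dup] wy /universalP tw n.
case: (pselect (universal n y)) => [ny|ny]; [by left; exists y|right].
have nwy : ~ (universal n y /\ universal w y) by case.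
apply: contrapT => /(separatorC nwy) sep.
apply/tw/(terminates_simulated sep).
by apply: contrapT => /universalP.
Qed.

Lemma delta_hull_separator w n y :
  (forall z, ~ (universal n z /\ universal w z)) ->
  separator w n y -> ~ delta_hull w y.
Proof.
by move=> nw /(separatorC (nw y)) ncosep /(_ n)[[z /nw]|].
Qed.

(** Here the system for [n] has an infinite run, which no successor in the terminating system for
    [w] can simulate. *)
Lemma universal_sub_separator w n :
  (forall y, ~ (universal n y /\ universal w y)) ->
  universal n `<=` separator w n.
Proof.
move=> nw y /[dup] ny /universalP tn.
apply/(separatorC (nw y)) => -[q [ext cosep]].
apply/tn/(terminates_simulated cosep).
suff tw : terminates (extends nth_pr y w) 0 by case: tw => h; exact: h.
by apply: contrapT => /universalP wy; apply: (nw y).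
Qed.

(** A point outside the hull fails the condition at some [n] with [universal n] disjoint from
    [universal w]; then [separator w n] is a Delta^1_1 neighbourhood of it missing the hull. *)
Lemma closed_delta_hull w : closed (delta_hull w : set delta_top).
Proof.
rewrite -[X in closed X]setCK; apply: open_closedC.
exists [set D | Delta11 D /\ D `<=` ~` delta_hull w]; first by move=> D [].
apply/seteqP; split=> y /=; first by move=> [D [_ sub] /sub].
move=> /existsNP[n /not_orP[nw ncosep]].
have {}nw z : ~ (universal n z /\ universal w z) by move=> h; apply: nw; exists z.
exists (separator w n); last exact/(separatorC (nw y)).
by split=> [|z]; [exact: Delta11_separator|exact: delta_hull_separator].
Qed.

Theorem theorem3p3 (Tc : Topological baire) :
  effective_topology Tc ->
  regular_space (Topological.Pack Tc) ->
  (@open (Topological.Pack Tc) : set (set baire)) `<=` @open sigma_delta_top.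
Proof.
move=> [B [Bopen Bnbhs] BSigma] reg U oU.
exists [set D | sigma_delta_base D /\ D `<=` U]; first by move=> D [].
apply/seteqP; split=> x /=; first by move=> [D [_ sub] /sub].
move=> Ux.
have [N nN clNU] := reg x U (@open_nbhs_nbhs (Topological.Pack Tc) x U (conj oU Ux)).
have [W [BW Wx] WN] := Bnbhs x N nN.
have [w Ww] := universal_Sigma11 (BSigma _ BW).
exists (delta_hull w); last by apply: universal_sub_delta_hull; rewrite -Ww.
split; first by split; [exact: Sigma11_delta_hull|exact: closed_delta_hull].
(* If [O] missed [N], then [O'] would miss [W], and the separator containing [O'] would put [y]
   outside the hull. *)
move=> y hy; apply: clNU => /= O /Bnbhs[O' [BO' O'y] O'O].
have [n On] := universal_Sigma11 (BSigma _ BO').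
apply: contrapT => WO; have nw z : ~ (universal n z /\ universal w z).
  move=> [nz wz]; apply: WO; exists z.
  by split; [apply: WN; rewrite Ww|apply: O'O; rewrite On].
apply: delta_hull_separator hy => //.
by apply: (universal_sub_separator nw); rewrite -On.
Qed.
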